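(* For $a\in\mathbb{N}$ let $$c_a=\lim_{N\to+\infty}\frac1N\#\{n\le N : s_2(n+a)\ge s_2(n)\}.$$ Then $\frac12$ is an accumulation point of the sequence $(c_a)_{a\in\mathbb{N}}$; that is, there is a strictly increasing sequence $(a_j)_{j\in\mathbb{N}}$ of non-negative integers with $c_{a_j}\to\frac12$ as $j\to+\infty$.
   Context: $\mathbb{N}=\{0,1,2,\dots\}$. For $n\in\mathbb{N}$, $s_2(n)$ is the number of digits $1$ in the binary expansion of $n$. For every $a\in\mathbb{N}$ and $d\in\mathbb{Z}$, the asymptotic density of $\{n\in\mathbb{N}: s_2(n+a)-s_2(n)=d\}$ is known to exist, and these densities sum to $1$ over $d\in\mathbb{Z}$ for each fixed $a$. *)

(* Defs.v *)
From HB Require Import structures.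
From mathcomp Require Import all_boot all_order all_algebra.
From mathcomp Require Import all_classical all_reals all_analysis.
Import numFieldNormedType.Exports.

Set Implicit Arguments.
Unset Strict Implicit.
Unset Printing Implicit Defensive.

Import Order.TTheory GRing.Theory Num.Theory.

(* The binary digit of n of weight 2 ^ i is (n %/ 2 ^ i) %% 2; it vanishes    *)
(* for i >= n because n < 2 ^ n, so the positions i < n are all the relevant  *)
(* ones.                                                                      *)
Definition s2 (n : nat) : nat := #|[set i : 'I_n | (n %/ 2 ^ i) %% 2 == 1]|.

Local Open Scope ring_scope.

(* The count ranges over 0 <= n <= N and is divided by N. The value 0 taken   *)
(* at N = 0 (since 0^-1 = 0) does not affect the limit.                       *)
Definition freq (R : realType) (a N : nat) : R :=
  N%:R^-1 * #|[set n : 'I_N.+1 | (s2 (n + a) >= s2 n)%N]|%:R.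

(* The limit exists for every a, so the total operator lim is never used      *)
(* outside of its domain.                                                     *)
Definition c (R : realType) (a : nat) : R := (lim (freq R a @ \oo))%classic.

(* Main.v *)
Require Import Defs.
From HB Require Import structures.
From mathcomp Require Import all_boot all_order all_algebra.
From mathcomp Require Import all_classical all_reals all_analysis.
From mathcomp Require Import zify ring lra.
Import numFieldNormedType.Exports.
Import Order.TTheory GRing.Theory Num.Theory.

(** Write delta b n = s2 (n + b) - s2 n and take a = b (2^L - 1) with 2^L much
    larger than b. Apart from a proportion O(b / 2^L), every n < 4^L is
    x 2^L + (b + y) with x, y < 2^L - b, and then n + a = (x + b) 2^L + y, so
    delta a n = delta b x - delta b y is antisymmetric in (x, y). Hence c_a is
    1/2 plus half the collision probability of delta b, which is at most the
    largest probability of a single value of delta b. This maximum is small for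
    b = 2^i1 + ... + 2^it with widely separated exponents: by the recursion
    for odd b, t - delta b is then close to a sum of t independent geometric
    variables, and the negative binomial weights C(r + t, t) / 2^(r + t) tend to
    0 uniformly in r. *)

(** * Binary digit sums, and finite sums split into blocks *)

Lemma s2E n M : n <= M -> s2 n = \sum_(i < M) (n %/ 2 ^ i) %% 2.
Proof.
move=> nM; rewrite /s2 -sum1dep_card big_mkcond /=.
rewrite -(big_mkord xpredT (fun i => if (n %/ 2 ^ i) %% 2 == 1 then 1 else 0)).
rewrite -(big_mkord xpredT (fun i => (n %/ 2 ^ i) %% 2)) [RHS](big_cat_nat (n := n)) //=.
rewrite [X in _ + X]big_nat_cond [X in _ + X]big1 ?addn0 => [|i /andP[/andP[ni _] _]].
  by apply: eq_bigr => i _; rewrite modn2; case: odd.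
by rewrite divn_small // (leq_ltn_trans ni) // ltn_expl.
Qed.

Lemma s2_0 : s2 0 = 0.
Proof. by rewrite (s2E 0 0 (leqnn 0)) big_ord0. Qed.

Lemma s2_double (e : bool) n : s2 (e + 2 * n) = e + s2 n.
Proof.
rewrite (s2E _ (2 * n).+2); last by case: e; lia.
rewrite (s2E n (2 * n).+1); last lia.
rewrite big_ord_recl /= expn0 divn1; congr (_ + _).
  by rewrite modn2 oddD oddM /= addbF oddb.
apply: eq_bigr => i _; congr (_ %% 2).
rewrite /bump /= add1n expnS divnMA; congr (_ %/ _).
by rewrite addnC mulnC divnMDl // divn_small ?addn0 //; case: (e).
Qed.

Lemma s2_even n : s2 (2 * n) = s2 n.
Proof. exact: s2_double false n. Qed.

Lemma s2_odd n : s2 (2 * n).+1 = (s2 n).+1.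
Proof. exact: s2_double true n. Qed.

Lemma s2_cat k q r : r < 2 ^ k -> s2 (q * 2 ^ k + r) = s2 q + s2 r.
Proof.
elim: k q r => [|k IH] q r; first by case: r => // _; rewrite muln1 s2_0 !addn0.
rewrite expnS => r_lt.
have -> : q * (2 * 2 ^ k) + r = odd r + 2 * (q * 2 ^ k + r./2).
  by rewrite -{1}(odd_double_half r); lia.
rewrite s2_double IH; last lia.
rewrite -{3}(odd_double_half r) -mul2n s2_double; lia.
Qed.

Lemma sum_bool_le n (h : nat -> bool) : \sum_(i < n) h i <= n.
Proof.
by rewrite -[leqRHS]card_ord -sum1_card; apply: leq_sum => i _; exact: leq_b1.
Qed.

Lemma sum_const_ord m n : \sum_(i < m) n = m * n.
Proof. by rewrite sum_nat_const card_ord. Qed.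

Lemma sum_blocks q m (F : nat -> nat) :
  \sum_(i < q * m) F i = \sum_(j < q) \sum_(r < m) F (j * m + r).
Proof.
elim: q => [|q IH]; first by rewrite mul0n !big_ord0.
by rewrite big_ord_recr /= -IH mulSnr big_split_ord.
Qed.

Lemma sum_parity n (F : nat -> nat) :
  \sum_(i < 2 * n) F i = \sum_(i < n) F (2 * i) + \sum_(i < n) F (2 * i).+1.
Proof.
rewrite mulnC sum_blocks -big_split; apply: eq_bigr => i _ /=.
by rewrite !big_ord_recr big_ord0 /= add0n addn0 addn1 mulnC.
Qed.

(** * Upper bounds for binomial coefficients *)

Lemma bin_central_max m k : 'C(2 * m, k) <= 'C(2 * m, m).
Proof.
have up j : 'C(2 * m, m + j) <= 'C(2 * m, m).
  elim: j => [|j IH]; first by rewrite addn0.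
  apply: leq_trans IH; rewrite addnS -(leq_pmul2l (ltn0Sn (m + j))).
  by rewrite mul_bin_left leq_mul2r; apply/orP; right; lia.
case: (leqP m k) => [mk|km]; first by rewrite -(subnKC mk).
rewrite -bin_sub; last lia.
by have -> : 2 * m - k = m + (m - k) by lia.
Qed.

(** From [m] to [m.+1] the left side is multiplied by 4 (2m + 1) (2m + 3) / (m + 1)^2, which is less
    than 16. *)
Lemma bin_central_bound m : 'C(2 * m, m) ^ 2 * (2 * m).+1 <= 4 ^ (2 * m).
Proof.
elim: m => [|m IH]; first by rewrite bin0.
have -> : 2 * m.+1 = (2 * m).+2 by lia.
have E1 := mul_bin_diag (2 * m).+2 m.
have E2 := mul_bin_down (2 * m).+1 m.
rewrite /= in E1 E2.
rewrite -(leq_pmul2l (_ : 0 < m.+1 ^ 2)) // -!mulnn !expnS.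
move: IH E1 E2; rewrite -mulnn.
have -> : (2 * m).+1 - m = m.+1 by lia.
set A := 'C(2 * m, m); set A1 := 'C((2 * m).+1, m); set A2 := 'C(_, m.+1).
set X := 4 ^ _ => IH E1 E2.
have EA : m.+1 * A2 = 2 * (2 * m).+1 * A by nia.
have -> : m.+1 * m.+1 * (A2 * A2 * (2 * m).+3) =
  (m.+1 * A2) * (m.+1 * A2) * (2 * m).+3 by ring.
rewrite EA.
have -> : 2 * (2 * m).+1 * A * (2 * (2 * m).+1 * A) * (2 * m).+3 =
  (A * A * (2 * m).+1) * (4 * ((2 * m).+1 * (2 * m).+3)) by ring.
apply: (leq_trans (leq_mul IH (leqnn _))).
have -> : m.+1 * m.+1 * (4 * (4 * X)) = X * (16 * (m.+1 * m.+1)) by ring.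
by rewrite leq_mul2l; apply/orP; right; nia.
Qed.

(** Even rows follow from the central bound. By Pascal's rule an entry of an odd row is at most
    twice the central entry of the row before. *)
Lemma bin_sqr_bound n k : 'C(n, k) ^ 2 * n <= 4 ^ n.
Proof.
rewrite -(odd_double_half n) -mul2n; set m := n./2.
have H := bin_central_bound m.
case: (odd n) => /=; rewrite ?add0n ?add1n; last first.
  by apply: leq_trans H; rewrite leq_mul ?leq_sqr ?bin_central_max.
rewrite [4 ^ _]expnS; apply: leq_trans (leq_mul (leqnn 4) H).
rewrite mulnA leq_mul2r; apply/orP; right.
have -> : 4 * 'C(2 * m, m) ^ 2 = (2 * 'C(2 * m, m)) ^ 2 by rewrite expnMn.
rewrite leq_sqr; case: k => [|k].
  by rewrite bin0; have := bin_central_max m 0; rewrite bin0; lia.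
by rewrite binS; have := bin_central_max m k; have := bin_central_max m k.+1; lia.
Qed.

(** * Distribution of [delta b] below a power of two *)

Definition delta (b n : nat) : int := (s2 (n + b))%:Z - (s2 n)%:Z.

(** Only [n] is confined below [2 ^ L], while [n + b] may exceed it; this keeps the recursions on
    the lowest digit exact. *)
Definition level (L b : nat) (d : int) : nat :=
  \sum_(n < 2 ^ L) (delta b n == d).

Definition nonneg_count (a N : nat) : nat :=
  \sum_(n < N) (s2 n <= s2 (n + a)).

Lemma level_le L b d : level L b d <= 2 ^ L.
Proof. exact: (sum_bool_le _ (fun n => delta b n == d)). Qed.

Lemma level_even L b d : level L.+1 (2 * b) d = 2 * level L b d.
Proof.
rewrite /level expnS (sum_parity _ (fun n => delta (2 * b) n == d : nat)).
rewrite [RHS]mul2n -[RHS]addnn; congr (_ + _); apply: eq_bigr => n _; rewrite /delta.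
  by rewrite -mulnDr !s2_even.
by rewrite addSn -mulnDr !s2_odd; congr nat_of_bool; lia.
Qed.

(** An even [n] absorbs the lowest digit 1 and gains one. An odd [n] loses one and sends a carry,
    which turns [b] into [b.+1]. *)
Lemma level_odd L b d :
  level L.+1 (2 * b).+1 d = level L b (d - 1) + level L b.+1 (d + 1).
Proof.
rewrite /level expnS (sum_parity _ (fun n => delta (2 * b).+1 n == d : nat)).
congr (_ + _); apply: eq_bigr => n _; rewrite /delta.
  by rewrite addnS -mulnDr s2_odd s2_even; congr nat_of_bool; lia.
have -> : (2 * n).+1 + (2 * b).+1 = 2 * (n + b.+1) by lia.
by rewrite s2_odd s2_even; congr nat_of_bool; lia.
Qed.

(** * Counting nonnegative increments over dyadic blocks *)

Lemma leq_sum_close m a (P Q : nat -> bool) :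
  (forall r, r + a < m -> P r = Q r) ->
  \sum_(r < m) P r <= \sum_(r < m) Q r + a.
Proof.
move=> PQ.
case: (leqP m a) => [ma|am].
  by rewrite (leq_trans (sum_bool_le _ _)) // (leq_trans ma) ?leq_addl.
have : m = (m - a) + a by lia.
move: (m - a) => t mE; rewrite mE !big_split_ord /=.
have -> : \sum_(i < t) P i = \sum_(i < t) Q i.
  by apply: eq_bigr => i _; rewrite PQ // mE; have := ltn_ord i; lia.
rewrite -addnA leq_add2l.
exact: leq_trans (sum_bool_le a (fun i => P (t + i))) (leq_addl _ _).
Qed.

(** No carry leaves the low block, so the digits of [j] cancel. *)
Lemma nonneg_block a k j r : r + a < 2 ^ k ->
  (s2 (j * 2 ^ k + r) <= s2 (j * 2 ^ k + r + a)) = (s2 r <= s2 (r + a)).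
Proof. by move=> h; rewrite -addnA !s2_cat ?leq_add2l //; lia. Qed.

Lemma nonneg_count_mul a k q :
  nonneg_count a (q * 2 ^ k) <= q * nonneg_count a (2 ^ k) + q * a /\
  q * nonneg_count a (2 ^ k) <= nonneg_count a (q * 2 ^ k) + q * a.
Proof.
rewrite /nonneg_count (sum_blocks _ _ (fun n => s2 n <= s2 (n + a) : nat)).
rewrite -!sum_const_ord -!big_split; split; apply: leq_sum => j _.
  apply: (leq_sum_close _ _ (fun r => s2 (j * 2 ^ k + r) <= s2 (j * 2 ^ k + r + a))
    (fun r => s2 r <= s2 (r + a))).
  by move=> r /nonneg_block.
apply: (leq_sum_close _ _ (fun r => s2 r <= s2 (r + a))
  (fun r => s2 (j * 2 ^ k + r) <= s2 (j * 2 ^ k + r + a))).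
by move=> r /nonneg_block.
Qed.

Lemma nonneg_count_le a N : nonneg_count a N <= N.
Proof. exact: (sum_bool_le _ (fun n => s2 n <= s2 (n + a))). Qed.

Lemma nonneg_countD a M N :
  nonneg_count a M <= nonneg_count a (M + N) <= nonneg_count a M + N.
Proof.
rewrite /nonneg_count big_split_ord /= leq_addr leq_add2l.
exact: (sum_bool_le N (fun i => s2 (M + i) <= s2 (M + i + a))).
Qed.

(** With denominators cleared: the proportion up to [N] is within a / m + m / N of p / m. Each
    complete block costs at most [a], the incomplete one at most [m]. *)
Lemma nonneg_count_scale a k N (m := 2 ^ k) (p := nonneg_count a m) :
  m * nonneg_count a N <= N * (p + a) + m * m /\
  N * p <= m * nonneg_count a N + N * a + m * p.
Proof.
have m_gt0 : 0 < m by rewrite expn_gt0.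
have [q [r [NE rm]]] : exists q r, N = q * m + r /\ r < m.
  by exists (N %/ m), (N %% m); rewrite -divn_eq ltn_mod.
have [U V] := nonneg_count_mul a k q.
have /andP[W X] := nonneg_countD a (q * m) r.
rewrite -NE -/m -/p in U V W X.
split.
  apply: (@leq_trans (m * (q * (p + a) + m))); first by rewrite leq_mul2l; lia.
  by rewrite mulnDr leq_add2r mulnA leq_mul2r; lia.
apply: (@leq_trans (m * (q * p) + m * p)).
  have -> : m * (q * p) + m * p = (q * m + m) * p by ring.
  by rewrite leq_mul2r; lia.
rewrite leq_add2r; apply: (@leq_trans (m * (nonneg_count a N + q * a))).
  by rewrite leq_mul2l; lia.
by rewrite mulnDr leq_add2l mulnA leq_mul2r; lia.
Qed.

(** * Existence of the density and its dyadic approximation *)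

Local Open Scope classical_set_scope.
Local Open Scope ring_scope.

Lemma freqE (R : realType) a N : freq R a N = N%:R^-1 * (nonneg_count a N.+1)%:R.
Proof.
congr (_ * _%:R); rewrite -sum1dep_card big_mkcond /=.
by apply: eq_bigr => i _; case: leqP.
Qed.

Lemma expn2_unbounded (R : realType) (x : R) : exists L0, forall L, (L0 <= L)%N -> x <= 2 ^+ L.
Proof.
have [n xn] : exists n : nat, x <= n%:R.
  exists (Num.bound `|x|); apply: ltW; apply: le_lt_trans (ler_norm x) _.
  exact: archi_boundP.
exists n => L nL; apply: (le_trans xn).
by rewrite -natrX ler_nat (leq_trans nL) // ltnW // ltn_expl.
Qed.

Lemma freq_near (R : realType) a k :
  \forall N \near \oo,
    `|freq R a N - (nonneg_count a (2 ^ k))%:R / 2 ^+ k| <= (a + 2)%:R / 2 ^+ k.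
Proof.
(* Beyond this threshold a slack of [2 * N] absorbs both the incomplete block and the mismatch
   between counting [N.+1] numbers and dividing by [N]. *)
exists (2 ^ k * (2 ^ k) + a).+1 => // N /= NE.
have [U V] := nonneg_count_scale a k N.+1.
have W := nonneg_count_le a (2 ^ k).
rewrite freqE.
have m0 : (0 : R) < 2 ^+ k by rewrite exprn_gt0.
have mE : (2 ^ k)%:R = 2 ^+ k :> R by rewrite natrX.
move: U V W NE; set S := nonneg_count a N.+1; set p := nonneg_count _ _.
set m := (2 ^ k)%N in mE * => U V W NE.
have N0 : (0 : R) < N%:R by rewrite ltr0n; lia.
have -> : N%:R^-1 * S%:R - p%:R / 2 ^+ k = (2 ^+ k * S%:R - N%:R * p%:R) / (N%:R * 2 ^+ k) :> R.
  by field; rewrite !gt_eqF.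
rewrite normrM normfV (gtr0_norm (mulr_gt0 N0 m0)) ler_pdivrMr ?mulr_gt0 //.
have -> : (a + 2)%:R / 2 ^+ k * (N%:R * 2 ^+ k) = ((a + 2) * N)%:R :> R.
  by rewrite natrM; field; rewrite gt_eqF.
have : (m * S)%:R <= (N * p + (a + 2) * N)%:R :> R by rewrite ler_nat; nia.
have : (N * p)%:R <= (m * S + (a + 2) * N)%:R :> R by rewrite ler_nat; nia.
by rewrite -mE -!natrM !natrD ler_norml => ? ?; apply/andP; split; lra.
Qed.

(** The dyadic proportions serve as centres of balls of arbitrarily small radius that eventually
    contain the frequencies. These are therefore Cauchy, and the bound of [freq_near] passes to the
    limit. *)
Lemma c_near (R : realType) a k :
  `|c R a - (nonneg_count a (2 ^ k))%:R / 2 ^+ k| <= (a + 2)%:R / 2 ^+ k.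
Proof.
have cv : cvg (freq R a @ \oo).
  apply: cauchy_cvg; apply: cauchy_exP => e e0.
  have [L0 /(_ L0 (leqnn _)) HL] := expn2_unbounded R ((a + 3)%:R / e).
  exists ((nonneg_count a (2 ^ L0))%:R / 2 ^+ L0).
  have := freq_near R a L0; apply: filterS => N HN.
  rewrite /= /ball /= distrC; apply: le_lt_trans HN _.
  rewrite ltr_pdivrMr ?exprn_gt0 // mulrC -ltr_pdivrMr //.
  by apply: lt_le_trans HL; rewrite ltr_pM2r ?invr_gt0 // ltr_nat; lia.
have F := freq_near R a k.
rewrite ler_norml lerBrDr lerBlDr; apply/andP; split.
  apply: limr_ge => //; apply: filterS F => N.
  by rewrite ler_norml => /andP[+ _]; rewrite lerBrDr.
apply: limr_le => //; apply: filterS F => N.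
by rewrite ler_norml => /andP[_]; rewrite lerBlDr.
Qed.

(** * Antisymmetry and the collision bound *)

Lemma delta_split L b x y : (x + b < 2 ^ L)%N -> (y + b < 2 ^ L)%N ->
  delta (b * (2 ^ L).-1) (x * 2 ^ L + (b + y)) = delta b x - delta b y.
Proof.
move=> xL yL; rewrite /delta.
have -> : (x * 2 ^ L + (b + y) + b * (2 ^ L).-1 = (x + b) * 2 ^ L + y)%N.
  have : (0 < 2 ^ L)%N by rewrite expn_gt0.
  by case: (2 ^ L)%N => // m _ /=; ring.
by rewrite (addnC b y) !s2_cat //; [lia | exact: leq_ltn_trans (leq_addr b y) yL].
Qed.

Lemma sum_ord_cut (h : nat -> nat) m n k : (m + n)%N = k ->
  (\sum_(i < k) h i = \sum_(i < m) h i + \sum_(i < n) h (m + i))%N.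
Proof. by move=> <-; rewrite big_split_ord. Qed.

Lemma nonneg_count_sym L b T (M := (2 ^ L)%N)
    (S := nonneg_count (b * M.-1) (M * M)) : (T + b)%N = M ->
  (M * M <= 2 * S + 2 * b * M)%N /\
  (2 * S <= M * M + \sum_(x < M) level L b (delta b x) + 4 * b * M)%N.
Proof.
move=> TM.
pose G := (\sum_(x < T) \sum_(y < T) (delta b y <= delta b x)%R)%N.
pose E := (\sum_(x < T) \sum_(y < T) (delta b y == delta b x))%N.
(* Exchanging [x] and [y] counts every pair once, and the ties twice. *)
have GE : (2 * G = T * T + E)%N.
  rewrite mul2n -addnn {2}/G exchange_big /= /G /E -!big_split /=.
  have -> : (T * T = \sum_(x < T) \sum_(y < T) 1)%N by rewrite !sum_const_ord muln1.
  rewrite -big_split; apply: eq_bigr => x _ /=.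
  rewrite -!big_split; apply: eq_bigr => y _ /=.
  by case: ltgtP.
have EL : (E <= \sum_(x < M) level L b (delta b x))%N.
  rewrite (sum_ord_cut (fun x => level L b (delta b x)) _ _ _ TM).
  apply: (@leq_trans (\sum_(x < T) level L b (delta b x))%N); last exact: leq_addr.
  apply: leq_sum => x _; rewrite /level -/M.
  by rewrite (sum_ord_cut (fun n => delta b n == delta b x : nat) _ _ _ TM) leq_addr.
have good n : (s2 n <= s2 (n + b * M.-1))%N = (0 <= delta (b * M.-1) n).
  by rewrite /delta; lia.
pose row x := (\sum_(r < M) (0 <= delta (b * M.-1) (x * M + r))%R)%N.
have SE : S = (\sum_(x < M) row x)%N.
  rewrite /S /nonneg_count (sum_blocks _ _ (fun n => s2 n <= s2 (n + b * M.-1) : nat))%N.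
  by apply: eq_bigr => x _; apply: eq_bigr => r _; rewrite good.
(* In row [x] the positions r < b are left uncontrolled; the others are r = b + y with y < T, where
   [delta_split] applies. *)
have rowE x : (x < T)%N -> exists2 e, (e <= b)%N &
    row x = (e + \sum_(y < T) (delta b y <= delta b x)%R)%N.
  move=> xT; exists (\sum_(r < b) (0 <= delta (b * M.-1) (x * M + r))%R)%N.
    exact: sum_bool_le b (fun r => 0 <= delta (b * M.-1) (x * M + r))%R.
  rewrite /row (sum_ord_cut (fun r => (0 <= delta (b * M.-1) (x * M + r))%R : nat)
    b T M); last by rewrite addnC.
  congr (_ + _)%N.
  apply: eq_bigr => y _; rewrite delta_split ?subr_ge0 // -/M; have := ltn_ord y; lia.
(* Two errors: [e1] from the last [b] rows, taken whole, and [e2] from the first [b] positions of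
   the other rows. *)
have S2 : exists2 e, (e <= 2 * b * M)%N & S = (G + e)%N.
  pose e1 := (\sum_(x < b) row (T + x))%N.
  pose e2 := (\sum_(x < T) (row x - \sum_(y < T) (delta b y <= delta b x)%R))%N.
  have e1b : (e1 <= b * M)%N.
    rewrite -sum_const_ord; apply: leq_sum => i _.
    exact: sum_bool_le M (fun r => 0 <= delta (b * M.-1) ((T + i) * M + r))%R.
  have e2b : (e2 <= T * b)%N.
    rewrite -sum_const_ord; apply: leq_sum => i _.
    by have [e ? ->] := rowE i (ltn_ord i); rewrite addnK.
  exists (e2 + e1)%N; first by nia.
  rewrite SE (sum_ord_cut row _ _ _ TM) addnA; congr (_ + _)%N.
  rewrite /G /e2 -big_split; apply: eq_bigr => x _ /=.
  by have [e _ ->] := rowE x (ltn_ord x); rewrite addnK addnC.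
have [e eb Se] := S2.
by rewrite Se; split; nia.
Qed.

(** Since [u] bounds the proportion of every value, it bounds the collision probability. The cut
    rows and positions cost 2b / 2^L, and passing from scale 4^L to the limit costs (b + 2) /
    2^L. *)
Lemma c_dist_half (R : realType) L b (u : R) : (b <= 2 ^ L)%N ->
  (forall d, (level L b d)%:R <= 2 ^+ L * u) ->
  `|c R (b * (2 ^ L).-1) - 2^-1| <= u / 2 + (3 * b + 2)%:R / 2 ^+ L.
Proof.
move=> bL lev; set M := (2 ^ L)%N; set a := (b * _)%N.
have ME : M%:R = 2 ^+ L :> R by rewrite natrX.
have m0 : (0 : R) < 2 ^+ L by rewrite exprn_gt0.
have [U V] := nonneg_count_sym L b (2 ^ L - b) (subnK bL).
have := c_near R a (L + L); rewrite exprD expnD -/M.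
move: U V; rewrite -/M -/a; set S := nonneg_count _ _ => U V C.
have Elev : (\sum_(x < M) level L b (delta b x))%:R <= 2 ^+ L * (2 ^+ L * u).
  rewrite natr_sum; apply: (@le_trans _ _ (\sum_(x < M) (2 ^+ L * u))).
    by apply: ler_sum => x _; exact: lev.
  by rewrite sumr_const card_ord -[leLHS]mulr_natl ME.
move: Elev V; set E := (\sum_(x < M) _)%N => Elev V.
have aM : (a + 2 <= (b + 2) * M)%N.
  have : (0 < M)%N by rewrite expn_gt0.
  rewrite /a -/M; nia.
set m : R := 2 ^+ L in ME m0 Elev C *.
have C2 : (a + 2)%:R / (m * m) <= (b + 2)%:R / m.
  rewrite ler_pdivrMr ?mulr_gt0 // mulrA divfK ?gt_eqF // -ME -natrM ler_nat //.
have {}U : m * m <= 2 * S%:R + 2 * b%:R * m.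
  by rewrite -ME -!natrM -natrD ler_nat.
have {}V : 2 * S%:R <= m * m + m * (m * u) + 4 * b%:R * m.
  apply: (@le_trans _ _ (m * m + E%:R + 4 * b%:R * m)).
    by rewrite -ME -!natrM -!natrD ler_nat.
  by rewrite lerD2r lerD2l.
have D : `|S%:R / (m * m) - 2^-1| <= u / 2 + 2 * b%:R / m.
  have u0 : 0 <= u.
    rewrite -(pmulr_rge0 _ m0); exact: le_trans (ler0n _ _) (lev 0).
  have -> : S%:R / (m * m) - 2^-1 = (2 * S%:R - m * m) / (2 * (m * m)).
    by field; rewrite gt_eqF.
  rewrite normrM normfV (gtr0_norm (_ : 0 < 2 * (m * m))) ?mulr_gt0 //.
  rewrite ler_pdivrMr ?mulr_gt0 //.
  have -> : (u / 2 + 2 * b%:R / m) * (2 * (m * m)) = m * (m * u) + 4 * b%:R * m.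
    by field; rewrite gt_eqF.
  have : 0 <= m * (m * u) by rewrite !mulr_ge0 // ltW.
  have : 0 <= b%:R * m by rewrite mulr_ge0 // ltW.
  by rewrite ler_norml => ? ?; apply/andP; split; lra.
have -> : c R a - 2^-1 = (c R a - S%:R / (m * m)) + (S%:R / (m * m) - 2^-1) by ring.
apply: (le_trans (ler_normD _ _)).
apply: (le_trans (lerD (le_trans C C2) D)).
have -> : (3 * b + 2)%:R = (b + 2)%:R + 2 * b%:R :> R by rewrite -natrM -natrD; congr _%:R; lia.
by rewrite addrCA lerD2l -mulrDl.
Qed.

(** * Negative binomial weights *)

(** With r = t - d, this is twice the probability that t + 1 independent geometric variables of
    parameter 1/2 sum to r. It dominates the law for t variables, obeys the same recursion, and
    needs no separate case at t = 0. *)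
Definition negbin (R : realType) (t : nat) (d : int) : R :=
  if t%:Z - d is Posz r then 'C(r + t, t)%:R / 2 ^+ (r + t) else 0.

Lemma negbin_ge0 (R : realType) t d : 0 <= negbin R t d.
Proof. by rewrite /negbin; case: (_ - _) => r //; rewrite divr_ge0 ?exprn_ge0. Qed.

(** Pascal's rule, in the form that matches [level_odd]. *)
Lemma negbin_rec (R : realType) t d :
  negbin R t.+1 d = (negbin R t (d - 1) + negbin R t.+1 (d + 1)) / 2.
Proof.
rewrite /negbin.
have -> : t%:Z - (d - 1) = t.+1%:Z - d by lia.
have -> : t.+1%:Z - (d + 1) = t.+1%:Z - d - 1 by lia.
case: (t.+1%:Z - d) => [[|r]|r].
- have -> : Posz 0 - 1 = Negz 0 by [].
  by rewrite !add0n !binn exprS; field; rewrite expf_neq0.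
- have -> : Posz r.+1 - 1 = Posz r by lia.
  rewrite addSn [in LHS]addnS binS addSn addnS natrD !exprS.
  by field; rewrite expf_neq0.
- have -> : Negz r - 1 = Negz r.+1 by lia.
  by rewrite addr0 mul0r.
Qed.

Lemma negbin_small (R : realType) (e : R) : 0 < e ->
  exists t, forall d, negbin R t d <= e.
Proof.
(* By [bin_sqr_bound] a weight is at most 1 / sqrt (r + n), hence at most 1 / sqrt n, which is less
   than e. *)
move=> e0; pose n := Num.bound (e ^- 2).
have en : e ^- 2 < n%:R by rewrite archi_boundP // invr_ge0 exprn_ge0 // ltW.
have n0 : (0 : R) < n%:R by apply: le_lt_trans en; rewrite invr_ge0 exprn_ge0 // ltW.
exists n => d; rewrite /negbin; case: (_ - _) => r; last exact: ltW.
have := bin_sqr_bound (r + n) n; set m := (r + n)%N => H.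
have mn : n%:R <= m%:R :> R by rewrite ler_nat leq_addl.
rewrite ler_pdivrMr ?exprn_gt0 // -ler_sqr ?nnegrE //; last first.
  by rewrite mulr_ge0 ?exprn_ge0 // ltW.
rewrite -(ler_pM2r (lt_le_trans n0 mn)).
have {}H : 'C(m, n)%:R ^+ 2 * m%:R <= (2 ^+ m) ^+ 2 :> R.
  rewrite -natrX -natrM; apply: (@le_trans _ _ ((4 ^ m)%:R)); first by rewrite ler_nat.
  by rewrite -exprM mulnC exprM -natrX -natrX.
apply: (le_trans H); rewrite exprMn mulrAC ler_peMl ?exprn_ge0 //.
by rewrite mulrC -ler_pdivrMr ?exprn_gt0 // mul1r (le_trans (ltW en)).
Qed.

(** * Domination of [level] by negative binomial weights *)

(** The threshold is uniform in [d], because the recursion shifts [d]; it may grow with [b], because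
    each appended digit uses up one level. *)
Definition level_bound (R : realType) (b t : nat) (e : R) : Prop :=
  exists L0, forall L d, (L0 <= L)%N ->
    (level L b d)%:R <= 2 ^+ L * (negbin R t d + e).

Lemma level0 L d : level L 0 d = (2 ^ L * (d == 0))%N.
Proof.
rewrite /level; under eq_bigr => n _ do rewrite /delta addn0 subrr eq_sym.
by rewrite sum_nat_const card_ord.
Qed.

Lemma level_bound0 (R : realType) : level_bound R 0 0 0.
Proof.
exists 0 => L d _; rewrite addr0 level0.
case: eqP => [->|_]; last by rewrite muln0 mulr_ge0 ?exprn_ge0 ?negbin_ge0.
by rewrite muln1 natrX /negbin subr0 /= bin0 divr1 mulr1.
Qed.

Lemma level_bound_pow2 (R : realType) b t (e : R) i :
  level_bound R b t e -> level_bound R (2 ^ i * b) t e.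
Proof.
elim: i => [|i IH]; first by rewrite mul1n.
move=> /IH [L0 HL]; exists L0.+1 => -[//|L] d /HL H.
by rewrite expnS -mulnA level_even natrM exprS -mulrA ler_pM2l.
Qed.

(* The digits 0 ... 01 appended to b contribute a geometric variable, up to an *)
(* error halved by each of the appended digits.                               *)
Lemma level_bound_append (R : realType) b t (e : R) i : 0 <= e ->
  level_bound R b t e -> level_bound R (2 ^ i * b).+1 t.+1 (e + 2 ^- i).
Proof.
move=> e0 Hb; elim: i => [|i [L1 H1]].
  (* For i = 0 the slack is at least 1, so the trivial bound suffices. *)
  exists 0 => L d _; rewrite expr0 invr1.
  apply: (@le_trans _ _ (2 ^+ L)); first by rewrite -natrX ler_nat level_le.
  by rewrite ler_peMr ?exprn_ge0 //; have := negbin_ge0 R t.+1 d; lra.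
(* [level_odd] leads to [2 ^ i * b], with slack [e], and to its successor, with slack [e + 2 ^- i];
   their mean is the new slack. *)
have [L0 H0] := level_bound_pow2 R b t e i Hb.
exists (maxn L0 L1).+1 => -[//|L] d; rewrite ltnS geq_max => /andP[/H0 h0 /H1 h1].
rewrite expnS -mulnA level_odd natrD.
apply: (le_trans (lerD (h0 (d - 1)) (h1 (d + 1)))).
rewrite -mulrDr exprSr -mulrA ler_pM2l ?exprn_gt0 //.
rewrite (negbin_rec R t d) exprS invfM; lra.
Qed.

Lemma exists_level_bound (R : realType) t (e : R) : 0 < e ->
  exists b, level_bound R b t e.
Proof.
elim: t e => [|t IH] e e0.
  exists 0; have [L0 H] := level_bound0 R; exists L0 => L d /H {}H.
  by apply: (le_trans (H d)); rewrite ler_pM2l ?exprn_gt0 //; lra.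
have [b Hb] := IH (e / 2) (divr_gt0 e0 (ltr0Sn _ _)).
have [i Hi] := expn2_unbounded R (2 / e).
exists (2 ^ i * b).+1.
have [L0 H] := level_bound_append R b t (e / 2) i (ltW (divr_gt0 e0 (ltr0Sn _ _))) Hb.
exists L0 => L d /H {}H; apply: (le_trans (H d)).
rewrite ler_pM2l ?exprn_gt0 // lerD2l.
have : 2 ^- i <= e / 2.
  by rewrite -[e / 2]invrK lef_pV2 ?posrE ?invr_gt0 ?divr_gt0 ?exprn_gt0 // invf_div Hi.
lra.
Qed.

(** * Construction of the sequence *)

Lemma level_small (R : realType) (e : R) : 0 < e -> e < 1 ->
  exists b L0, (0 < b)%N /\ forall L d, (L0 <= L)%N -> (level L b d)%:R <= 2 ^+ L * e.
Proof.
move=> e0 e1; have e2 : 0 < e / 2 by rewrite divr_gt0.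
have [t Ht] := negbin_small R _ e2.
have [b [L0 H]] := exists_level_bound R t _ e2.
have {}H L d : (L0 <= L)%N -> (level L b d)%:R <= 2 ^+ L * e.
  move=> /H /le_trans; apply; rewrite ler_pM2l ?exprn_gt0 //.
  by have := Ht d; lra.
(* If b = 0, the value 0 has proportion 1, against e < 1. *)
exists b, L0; split => //; case: b H => // /(_ L0 0 (leqnn _)).
by rewrite level0 eqxx muln1 natrX ler_pMr ?exprn_gt0 // leNgt e1.
Qed.

Lemma c_close_half (R : realType) (e : R) B : 0 < e ->
  exists2 a, (B < a)%N & `|c R a - 2^-1| < e.
Proof.
wlog e1 : e / e < 1.
  move=> W e0; have [||a Ba Ha] := W (Num.min e 2^-1).
  - by rewrite gt_min; apply/orP; right; lra.
  - by rewrite lt_min e0 /=; lra.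
  by exists a => //; apply: lt_le_trans Ha _; rewrite ge_min lexx.
move=> e0; have [b [L0 [b0 H]]] := level_small R e e0 e1.
have [L1 H1] := expn2_unbounded R ((3 * b + 2)%:R * 4 / e).
(* [L0] bounds the levels by [e], [L1] makes the remaining error at most e / 4, [b] gives b <= 2^L,
   and B + 2 gives 2^L - 1 > B. *)
pose L := (L0 + L1 + b + B + 2)%N.
have LL : (L < 2 ^ L)%N by rewrite ltn_expl.
exists (b * (2 ^ L).-1)%N; first by rewrite /L in LL *; nia.
have := c_dist_half R L b e; move=> /(_ _ _)/le_lt_trans; apply.
- by rewrite /L in LL *; lia.
- by move=> d; apply: H; rewrite /L; lia.
have : (3 * b + 2)%:R / 2 ^+ L <= e / 4.
  have /H1 : (L1 <= L)%N by rewrite /L; lia.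
  by rewrite ler_pdivrMr // [in _ -> _]ler_pdivrMr ?exprn_gt0 // => h; lra.
lra.
Qed.

Theorem mainTheorem2 (R : realType) :
  exists a : nat -> nat,
    (forall i j : nat, (i < j)%N -> (a i < a j)%N) /\
    (fun j : nat => c R (a j)) @ \oo --> (2^-1 : R).
Proof.
(* [p.1] sets the precision and [p.2] a lower bound; feeding the previous term in as [p.2] makes the
   sequence strictly increasing. *)
have close (p : nat * nat) :
    exists a, (p.2 < a)%N /\ `|c R a - 2^-1| < p.1.+1%:R^-1.
  by have [|a ? ?] := c_close_half R p.1.+1%:R^-1 p.2; rewrite ?invr_gt0 //; exists a.
have [f Hf] := choice close.
pose a := fix a j := if j is i.+1 then f (j, a i) else f (0, 0)%N.
exists a; split; first by apply: (homo_ltn ltn_trans) => i; exact: (Hf (i.+1, a i)).1.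
have aP j : `|c R (a j) - 2^-1| < j.+1%:R^-1.
  by case: j => [|j]; [exact: (Hf (0, 0)%N).2 | exact: (Hf (j.+1, a j)).2].
apply/cvgrPdist_lt => e e0; exists (Num.bound e^-1) => // j /= ej.
rewrite distrC; apply: lt_trans (aP j) _.
rewrite -[e]invrK ltf_pV2 ?posrE ?invr_gt0 //.
apply: lt_le_trans (archi_boundP _) _; first by rewrite invr_ge0 ltW.
by rewrite ler_nat ltnW.
Qed.
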